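(* Let $X$ be a topological space and let $\mathscr{B}$ be a family of covers of $X$ which is Ramseyan and finite-to-one derefinable. Then the following are equivalent: (1) $X$ satisfies $\mathsf{S}_{\mathrm{fin}}(\Omega,\gimel(\mathscr{B}))$. (2) For each positive integer $k$, $\Omega\to\lceil\gimel(\mathscr{B})\rceil^2_k$ holds. (3) $\Omega\to\lceil\gimel(\mathscr{B})\rceil^2_2$ holds.
   Context: Convention: a cover of the topological space $X$ is always a countable collection $\mathcal{U}$ of open subsets of $X$ such that $\bigcup\mathcal{U}=X$ and $X\notin\mathcal{U}$. $\mathscr{A},\mathscr{B}$ denote families of such covers of the underlying space $X$. $\mathcal{O}$ is the family of all covers of $X$. $\mathcal{U}$ is an $\omega$-cover if $X\notin\mathcal{U}$ and for each finite $F\subseteq X$ there is $U\in\mathcal{U}$ with $F\subseteq U$; $\Omega$ is the family of all $\omega$-covers of $X$. $\mathscr{A}$ is Ramseyan if for each $\mathcal{U}\in\mathscr{A}$ and each partition of $\mathcal{U}$ into finitely many (equivalently, two) pieces, one of these pieces belongs to $\mathscr{A}$. A cover $\mathcal{V}$ is a finite-to-one derefinement of a cover $\mathcal{U}$ if there is a finite-to-one surjection $f:\mathcal{U}\to\mathcal{V}$ such that $U\subseteq f(U)$ for each $U\in\mathcal{U}$. $\mathscr{A}$ is finite-to-one derefinable if for each $\mathcal{U}\in\mathscr{A}$ and each finite-to-one derefinement $\mathcal{V}\in\mathcal{O}$ of $\mathcal{U}$, $\mathcal{V}\in\mathscr{A}$. A cover $\mathcal{U}$ of $X$ is multifinite if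 there is a partition of $\mathcal{U}$ into infinitely many finite covers of $X$. $\gimel(\mathscr{A})$ is the family of all covers $\mathcal{U}$ of $X$ such that either $\mathcal{U}$ is multifinite, or there is a partition $\mathcal{P}$ of $\mathcal{U}$ into finite sets such that $\{\bigcup\mathcal{F}:\mathcal{F}\in\mathcal{P}\}\setminus\{X\}\in\mathscr{A}$. $\mathsf{S}_{\mathrm{fin}}(\mathscr{A},\mathscr{B})$: for each sequence $\{\mathcal{U}_n\}_{n\in\mathbb{N}}$ of members of $\mathscr{A}$ there are finite subsets $\mathcal{F}_n\subseteq\mathcal{U}_n$, $n\in\mathbb{N}$, such that $\bigcup_n\mathcal{F}_n\in\mathscr{B}$. $[A]^n$ denotes the set of $n$-element subsets of $A$. For a positive integer $k$, the Baumgartner-Taylor partition relation $\mathscr{A}\to\lceil\mathscr{B}\rceil^2_k$ is the statement: for each $A\in\mathscr{A}$ and each $f:[A]^2\to\{1,\dots,k\}$ there are $B\subseteq A$ with $B\in\mathscr{B}$, a partition of $B$ into finite pieces $B=\bigcup_{n\in\mathbb{N}}B_n$, and $j\in\{1,\dots,k\}$, such that $f(\{U,V\})=j$ for all $U,V\in B$ which do not belong to the same $B_n$. *)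

(* Defs.v *)
From mathcomp Require Import all_boot.
From mathcomp Require Import all_classical topology.

Set Implicit Arguments.
Unset Strict Implicit.
Unset Printing Implicit Defensive.

Local Open Scope classical_set_scope.

(* In [partition P id U], [P] is a set of subsets of [U]: its members are
   nonempty, pairwise disjoint, and have union [U]. *)

Section Families.
Variable T : Type.
Implicit Types (U V A B : set T) (AA BB : set (set T)).

Definition Ramseyan AA : Prop :=
  forall U, AA U ->
  forall P : set (set T), finite_set P -> partition P id U ->
  exists2 V, P V & AA V.

Definition finite_to_one (T' : Type) U (f : T -> T') : Prop :=
  forall y, finite_set (U `&` f @^-1` [set y]).

Definition Sfin AA BB : Prop :=
  forall U : nat -> set T, (forall n, AA (U n)) ->
  exists F : nat -> set T,
    (forall n, finite_set (F n) /\ F n `<=` U n) /\ BB (\bigcup_n F n).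

Definition n_subsets (n : nat) A : set (set T) :=
  [set S | S `<=` A /\ (S #= `I_n)%card].

(* A colouring of [n_subsets 2 A] is a total function on [set T], of which only
   the values on two-element subsets of [A] matter.  The blocks [Bn n] may be
   empty, so that finite sets [B] are not excluded. *)
Definition BaumgartnerTaylor AA BB (k : nat) : Prop :=
  forall A, AA A ->
  forall f : set T -> nat,
    set_fun (n_subsets 2 A) [set j | (1 <= j <= k)%N] f ->
  exists B (Bn : nat -> set T) (j : nat),
    [/\ B `<=` A, BB B,
        [/\ \bigcup_n Bn n = B, trivIset setT Bn & forall n, finite_set (Bn n)],
        (1 <= j <= k)%N &
        forall x y, B x -> B y -> ~ (exists n, Bn n x /\ Bn n y) ->
          f [set x; y] = j].

End Families.

Section Covers.
Variable X : topologicalType.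
Implicit Types (U V : set (set X)) (AA : set (set (set X))).

Definition Covers : set (set (set X)) :=
  [set U | [/\ countable U, forall W, U W -> open W,
               \bigcup_(W in U) W = setT & ~ U setT]].

Definition Omega : set (set (set X)) :=
  [set U | Covers U /\
    forall F : set X, finite_set F -> exists2 W, U W & F `<=` W].

Definition finite_to_one_derefinement U V : Prop :=
  exists f : set X -> set X,
    [/\ f @` U = V, finite_to_one U f & forall W, U W -> W `<=` f W].

Definition finite_to_one_derefinable AA : Prop :=
  forall U V, AA U -> Covers V -> finite_to_one_derefinement U V -> AA V.

Definition multifinite U : Prop :=
  exists P : set (set (set X)),
    [/\ partition P id U, infinite_set P &
        forall F, P F -> finite_set F /\ Covers F].

Definition gimel AA : set (set (set X)) :=
  [set U | Covers U /\
    (multifinite U \/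
     exists P : set (set (set X)),
       [/\ partition P id U, forall F, P F -> finite_set F &
           AA ([set \bigcup_(W in F) W | F in P] `\ setT)])].

End Covers.

Arguments Covers X : clear implicits.
Arguments Omega X : clear implicits.

(* Main.v *)
Require Import Defs.
From mathcomp Require Import all_boot finmap zify.
From mathcomp Require Import all_classical topology.

(** Write gimel for the family of covers built from the given family BB.

From the selection principle to the partition relation. On an omega-cover A take
an ultrafilter whose members are omega-covers. For U in A the colour f {U, W} is
constant on a large set of W, and that constant is the same colour j for a large
set C of U. So for finitely many U in C, the W in C with f {U, W} = j for all
these U still form an omega-cover ([Omega_end_homogeneous]). Apply the selection
principle to these covers, the n-th one taking care of the members of C of rank
below n, for a finite-to-one rank: the selected V in gimel has the property that
every U in V satisfies f {U, W} = j for all but finitely many W in V. Let P be a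
partition of V into finite sets that witnesses V in gimel. The graph on V that
joins U and W if f {U, W} <> j or if they share a block of P is locally finite,
so V can be cut into finite consecutive layers such that edges join only equal
or consecutive layers. Each block of P lies in two consecutive layers; colour it
by the lower one modulo 3. Since BB is Ramseyan, some blocks of one colour have
a union in gimel ([gimel_partition_colour]), and in this union edges are
confined to the finite pieces made of two consecutive layers
([sparse_colouring]).

From the partition relation for two colours to the selection principle. Given
omega-covers G n and a finite-to-one rank on their union, first delete from G n
the sets of rank at most n, so that each set belongs to finitely many of the
resulting H n. Consider the omega-cover of all intersections of a member W of H
0, of rank n say, with a member of H n, and colour a pair according to whether
the chosen first factors agree. A homogeneous V in gimel with colour agree would
lie below one W <> X, which is impossible; with colour differ, each first factor
occurs finitely often in V, so the second factors select finitely many members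
of each H n. Passing from an intersection to its second factor is finite-to-one,
so it remains to see that gimel inherits finite-to-one derefinability
([gimel_derefinable]).

The difficulty of this last point is that the images of the blocks of P overlap
and that their unions may coincide or equal X. The criterion
[gimel_point_finite] deals with it: overlaps are removed by the same colouring
modulo 3 of a locally finite graph, and [gimel_block_ranked] groups the
resulting finite sets into longer and longer intervals, so that the unions are
pairwise distinct unless they equal X. If X occurs infinitely often, the cover
is multifinite, and otherwise derefinability of BB applies. *)

Set Implicit Arguments.
Unset Strict Implicit.
Unset Printing Implicit Defensive.

Local Open Scope classical_set_scope.

(** * Finite-to-one ranks and layers of locally finite graphs *)

Section Finiteness.
Variable T : Type.
Implicit Types (U V S : set T) (r : T -> nat).

Lemma finite_bounded S r : finite_set S -> exists n, forall x, S x -> (r x < n)%N.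
Proof.
move=> /(finite_image r)/finite_seqP[s sE].
exists (\max_(i <- s) i).+1 => x Sx; rewrite ltnS.
have : r x \in s by have : [set` s] (r x) by rewrite -sE; exists x.
by move=> rs; exact: (@leq_bigmax_seq _ s xpredT id).

Qed.

Lemma countable_rank V : countable V -> exists r, finite_to_one V r.
Proof.
case/countable_injP => r rinj; exists r => n.
have [[x [Vx rx]]|none] := pselect (exists x, V x /\ r x = n).
  apply: (sub_finite_set _ (finite_set1 x)) => y [Vy /= ry].
  by apply: rinj; rewrite ?inE// ry rx.
by apply: (sub_finite_set _ (@finite_set0 T)) => y [Vy /= ry]; case: none; exists y.
Qed.

Lemma finite_to_one_below V r n :
  finite_to_one V r -> finite_set [set x | V x /\ (r x < n)%N].
Proof.
move=> rfin; apply: (@sub_finite_set _ _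
  (\bigcup_(i in `I_n) (V `&` r @^-1` [set i]))).
  by move=> x [Vx rx]; exists (r x).
by apply: bigcup_finite => [|i _]; [exact: finite_II|exact: rfin].
Qed.

End Finiteness.

Lemma finite_set_ifN0 (T : Type) (A : set T) :
  (A !=set0 -> finite_set A) -> finite_set A.
Proof. by have [->//|/set0P AN0 /(_ AN0)] := eqVneq A set0. Qed.

Lemma disjoint_point_finite (T : Type) (P : set (set T)) x :
  trivIset P id -> finite_set [set F | P F /\ F x].
Proof.
move=> Pdisj; apply: finite_set_ifN0 => -[F [PF Fx]].
apply: (sub_finite_set _ (finite_set1 F)) => F' [PF' F'x].
by apply: Pdisj => //; exists x.
Qed.

(** A requirement R m n that holds for all large n can be met by consecutive
cut points of the natural numbers.  The index J n of the interval
k j <= i < k j.+1 that contains n is given through the adjunction between J and k,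
from which the monotonicity of both and all bounds follow. *)
Lemma interval_blocks (R : nat -> nat -> Prop) :
    (forall m, exists n0, forall n, (n0 <= n)%N -> R m n) ->
  exists k J : nat -> nat,
    (forall j n, (j <= J n)%N = (k j <= n)%N) /\ forall j, R (k j) (k j.+1).
Proof.
move=> /choice[e eP].
pose k := fix k j := if j is i.+1 then (maxn (k i).+1 (e (k i))) else 0%N.
have kS j : (k j < k j.+1)%N by rewrite /= leq_maxl.
have kmono : {homo k : i j / (i <= j)%N}.
  by apply: homo_leq => [//|? ? ?|i]; [exact: leq_trans|exact: ltnW].
have /choice[J JP] n : exists j, (k j <= n < k j.+1)%N.
  elim: n => [|n [j /andP[jn nj]]]; first by exists 0%N; rewrite leq0n (kS 0%N).
  have [lt|ge] := ltnP n.+1 (k j.+1); first by exists j; rewrite lt leqW.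
  by exists j.+1; rewrite ge (leq_ltn_trans nj)// kS.
exists k, J; split=> [j n|j]; last by apply: eP; rewrite /= leq_maxr.
have /andP[Jn nJ] := JP n.
apply/idP/idP => [/kmono/leq_trans|kn]; first exact.
by rewrite leqNgt; apply/negP => /kmono /leq_trans/(_ kn); rewrite leqNgt nJ.
Qed.

Section Layers.
Variables (T : Type) (V : set T) (L : T -> T -> Prop).

(** Along a rank function of V, cut so far apart that all neighbours of what lies
before one cut lie before the next one: an edge then cannot jump over a whole
interval. *)
Lemma locally_finite_layering :
    countable V ->
    (forall x, V x -> finite_set [set y | V y /\ L x y]) ->
  exists2 J : T -> nat, finite_to_one V J &
    forall x y, V x -> V y -> L x y -> (J y <= (J x).+1)%N.
Proof.
move=> /countable_rank[r rfin] Lfin.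
pose R m n := (m <= n)%N /\
  forall x y, V x -> V y -> L x y -> (r x < m)%N -> (r y < n)%N.
have [m|k [J [kJ kR]]] := @interval_blocks R.
  have [n nP] : exists n, forall y,
      (\bigcup_(x in [set x | V x /\ (r x < m)%N]) [set y | V y /\ L x y]) y ->
      (r y < n)%N.
    apply: finite_bounded; apply: bigcup_finite.
      exact: finite_to_one_below.
    by move=> x [Vx _]; exact: Lfin.
  exists (maxn m n) => n'; rewrite geq_max => /andP[mn' nn']; split=> //.
  by move=> x y Vx Vy Lxy xm; apply: leq_trans nn'; apply: nP; exists x.
exists (J \o r) => [j|x y Vx Vy Lxy /=].
  apply: (sub_finite_set _ (finite_to_one_below (k j.+1) rfin)) => x [Vx /= Jx].
  by split=> //; rewrite ltnNge -kJ Jx ltnn.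
rewrite leqNgt kJ -ltnNge.
by apply: (kR (J (r x)).+1).2 Lxy _ => //; rewrite ltnNge -kJ ltnn.
Qed.

(** The finite cliques G i get finitely many colours such that, inside one colour
class, all edges stay within the finite fibres of one function b c.  A clique
meets at most two consecutive layers q and q + 1; cliques with the same q modulo
3 but different q are separated by a whole layer, so no edge joins them. *)
Lemma sparse_colouring (I : Type) (D : set I) (G : I -> set T) :
    countable V ->
    (forall x, V x -> finite_set [set y | V y /\ L x y]) ->
    (forall x y, V x -> V y -> L x y -> L y x) ->
    (forall i, D i -> G i `<=` V) ->
    (forall i x y, D i -> G i x -> G i y -> L x y) ->
  exists (col : I -> nat) (b : nat -> T -> nat),
    [/\ forall i, (col i < 3)%N, forall c, finite_to_one V (b c) &
        forall c i i' x y, D i -> D i' -> col i = c -> col i' = c ->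
          G i x -> G i' y -> L x y -> b c x = b c y].
Proof.
move=> Vc Lfin Lsym GV GL.
have [J Jfin JL] := locally_finite_layering Vc Lfin.
have /choice[q qP] i : exists q, D i -> forall x, G i x -> (q <= J x <= q.+1)%N.
  have [[x0 [Di Gx0]]|none] := pselect (exists x, D i /\ G i x); last first.
    by exists 0%N => Di x Gx; case: none; exists x.
  have exJ : exists n, `[< exists2 x, G i x & J x = n >].
    by exists (J x0); apply/asboolP; exists x0.
  exists (ex_minn exJ) => _ x Gx.
  case: ex_minnP => m /asboolP[y Gy <-] mmin; apply/andP; split.
    by apply: mmin; apply/asboolP; exists x.
  by apply: JL; [exact: (GV i)..|exact: (GL i)].
(* For q i = c + 3 a, both layers q i and (q i).+1 are sent to a + 1; this also
brings layer q i + 2 along, which no clique of colour c meets. *)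
exists (fun i => q i %% 3)%N, (fun c x => (J x + (3 - c)) %/ 3)%N; split.
- by move=> i; rewrite ltn_mod.
- move=> c n; apply: (sub_finite_set _ (finite_to_one_below (3 * n.+1)%N Jfin)).
  by move=> x [Vx /= bx]; split=> //; lia.
- move=> c i i' x y Di Di' ci ci' Gx Gy Lxy.
  have Vx : V x by exact: GV Gx.
  have Vy : V y by exact: GV Gy.
  have := JL x y Vx Vy Lxy; have := JL y x Vy Vx (Lsym _ _ Vx Vy Lxy).
  by have := qP i Di x Gx; have := qP i' Di' y Gy; lia.
Qed.

End Layers.

(** * Covers, and families of covers with the Ramsey property *)

Section Covers.
Variable X : topologicalType.
Implicit Types (U W : set X) (V Q : set (set X)).

Lemma sub_Covers V V' : Covers X V -> V' `<=` V ->
  (forall x, exists2 W, V' W & W x) -> Covers X V'.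
Proof.
move=> [Uc Uo _ UT] VU Vcov; split.
- exact: sub_countable (subset_card_le VU) Uc.
- by move=> W /VU /Uo.
- by apply/seteqP; split=> // x _; have [W] := Vcov x; exists W.
- by move/VU.
Qed.

Lemma Covers_covers V x : Covers X V -> exists2 W, V W & W x.
Proof.
case=> _ _ UE _; have : [set: X] x by [].
by rewrite -UE => -[W]; exists W.
Qed.

(** Finite subcovers that need not be disjoint suffice.  Since each member of V
lies in only finitely many of them, some G i is disjoint from any given finite
part of V; so V can be cut into intervals each of which contains a whole G i. *)
Lemma multifiniteI V (I : Type) (D : set I) (G : I -> set (set X)) :
    [set: X] !=set0 -> Covers X V -> infinite_set D ->
    (forall i, D i -> G i `<=` V) ->
    (forall i x, D i -> exists2 U, G i U & U x) ->
    (forall U, V U -> finite_set [set i | D i /\ G i U]) ->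
    (forall i, D i -> finite_set (G i)) ->
  multifinite V.
Proof.
move=> [x0 _] Vcov Dinf GV Gcov Gpf Gfin.
have [/countable_rank[r rfin] _ _ _] := Vcov.
pose R m n := exists2 i, D i & forall U, G i U -> (m <= r U < n)%N.
have [m|k [J [kJ kR]]] := @interval_blocks R.
  have Efin : finite_set
      (\bigcup_(U in [set U | V U /\ (r U < m)%N]) [set i | D i /\ G i U]).
    apply: bigcup_finite; first exact: finite_to_one_below.
    by move=> U [VU _]; exact: Gpf.
  have [i [Di iE]] := infinite_setN0 (infinite_setD Dinf Efin).
  have [n nP] := finite_bounded r (Gfin i Di).
  exists n => n' nn'; exists i => // U GU.
  rewrite (leq_trans (nP U GU))// andbT leqNgt; apply/negP => rm.
  by apply: iE; exists U => //; split=> //; exact: GV GU.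
pose B j := V `&` (J \o r) @^-1` [set j].
have Bcov j x : exists2 U, B j U & U x.
  have [i Di iP] := kR j; have [U GU Ux] := Gcov i x Di.
  exists U => //; split; first exact: GV GU.
  have /andP[lo hi] := iP U GU.
  by apply/eqP; rewrite eqn_leq /= kJ lo andbT -ltnS ltnNge kJ -ltnNge.
exists (range B); split.
- split.
  + apply/seteqP; split=> [U [_ [j _ <-] []//]|U VU].
    by exists (B (J (r U))); [exists (J (r U))|split].
  + by move=> _ _ [i _ <-] [j _ <-] [U [[_ <-] [_ <-]]].
  + by move=> _ [j _ <-]; have [U BU _] := Bcov j x0; exists U.
(* Finitely many blocks would make the union V of the blocks finite, hence
bounded in J, while every interval is inhabited. *)
- move=> Pfin.
  have Vfin : finite_set (\bigcup_(F in range B) F).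
    apply: bigcup_finite => // _ [j _ <-].
    apply: (sub_finite_set _ (finite_to_one_below (k j.+1) rfin)) => U [VU /= JU].
    by split=> //; rewrite ltnNge -kJ JU ltnn.
  have [n nP] := finite_bounded (J \o r) Vfin.
  have [U [VU /= JU] _] := Bcov n x0.
  suff : (J (r U) < n)%N by rewrite JU ltnn.
  by apply: nP; exists (B n); [exists n|].
- move=> _ [j _ <-]; split.
    apply: (sub_finite_set _ (finite_to_one_below (k j.+1) rfin)) => U [VU /= JU].
    by split=> //; rewrite ltnNge -kJ JU ltnn.
  by apply: sub_Covers Vcov _ (Bcov j) => U [].
Qed.

End Covers.

Section Ramseyan.
Variables (T : Type) (BB : set (set (set T))).
Hypothesis BB_Ramseyan : Ramseyan BB.
Implicit Types (Q : set (set T)).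

(** The Ramsey property in terms of colourings; empty colour classes have to be
discarded, as the pieces of a partition are nonempty. *)
Lemma Ramseyan_colour Q (col : set T -> nat) m : BB Q ->
  (forall W, Q W -> (col W < m)%N) -> exists c, BB (Q `&` col @^-1` [set c]).
Proof.
move=> BQ colm.
pose P := ((fun c => Q `&` col @^-1` [set c]) @` `I_m) `\ set0.
suff [V [[c _ <-] _]] : exists2 V, P V & BB V by exists c.
apply: BB_Ramseyan BQ _ _ _.
  by apply: finite_setD; apply: finite_image; exact: finite_II.
split.
- apply/seteqP; split=> [W [_ [[c _ <-] _] []//]|W QW].
  exists (Q `&` col @^-1` [set col W]) => //; split.
    by exists (col W) => //=; exact: colm.
  by move=> /= e; suff : set0 W by []; rewrite -e.
- by move=> _ _ [[c _ <-] _] [[d _ <-] _] [W [[_ <-] [_ <-]]].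
- by move=> V [_ /eqP/set0P].
Qed.

End Ramseyan.

(** * Membership in gimel *)

Section Gimel.
Variables (X : topologicalType) (BB : set (set (set X))).
Hypothesis X_inhabited : [set: X] !=set0.
Hypothesis BB_covers : BB `<=` Covers X.
Hypothesis BB_Ramseyan : Ramseyan BB.
Hypothesis BB_derefinable : finite_to_one_derefinable BB.
Implicit Types (U W : set X) (V Q : set (set X)).

(** Partition a finite member into singletons: one of them would be a cover,
whose only element is then the whole space. *)
Lemma Ramseyan_covers_infinite Q : BB Q -> infinite_set Q.
Proof.
move=> BQ Qfin.
pose P := [set [set W] | W in Q].
have [] : exists2 V, P V & BB V.
  apply: BB_Ramseyan BQ _ _ _; first exact: finite_image.
  split.
  - apply/seteqP; split=> [W [_ [W' QW' <-] ->]//|W QW].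
    by exists [set W] => //; exists W.
  - by move=> _ _ [V _ <-] [W _ <-] [U [-> ->]].
  - by move=> _ [V _ <-]; exists V.
move=> _ [W QW <-] /BB_covers[_ _ WT]; apply.
by rewrite bigcup_set1 in WT; rewrite /= -{1}WT.
Qed.

Lemma Ramseyan_cofinite Q E : BB Q -> finite_set E -> BB (Q `\` E).
Proof.
move=> BQ Efin.
have [|c] := @Ramseyan_colour _ _ BB_Ramseyan Q
  (fun W => if `[< E W >] then 0 else 1)%N 2 BQ.
  by move=> W _; case: ifP.
have [->|c0 BQc] := eqVneq c 0%N.
  move=> /Ramseyan_covers_infinite[]; apply: sub_finite_set Efin.
  by move=> W [_ /=]; case: asboolP.
suff <- : Q `&` (fun W => if `[< E W >] then 0%N else 1%N) @^-1` [set c] =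
    Q `\` E by [].
have [W [QW /= Wc]] := infinite_setN0 (Ramseyan_covers_infinite BQc).
have {Wc} c1 : c = 1%N by move: Wc c0; case: ifP => _ <-.
rewrite {}c1; apply/seteqP; split=> V [QV /=].
  by case: asboolP.
by move=> EV; split=> //=; case: asboolP.
Qed.

Lemma gimel_infinite V : gimel BB V -> infinite_set V.
Proof.
move=> [_ VP] Vfin.
have Pfin P : partition P id V -> finite_set P.
  move=> [PV Pdisj PN0].
  apply: (sub_finite_set (B := \bigcup_(W in V) [set F | P F /\ F W])).
    move=> F PF; have [W FW] := PN0 F PF.
    by exists W => //; rewrite -PV; exists F.
  by apply: bigcup_finite => // W _; exact: disjoint_point_finite.
case: VP => [[P [/Pfin? Pinf _]]|[P [/Pfin PF _]]]; first exact: Pinf.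
by move=> /Ramseyan_covers_infinite; apply; apply: finite_setD; exact: finite_image.
Qed.

(** Group the blocks of b into intervals, with unions Z j.  Every tail of the
blocks still covers the space, because removing finitely many members of Q
leaves a member of BB; hence an interval that is long enough contains points
outside each of the finitely many earlier unions other than X.  So the Z j
different from X are pairwise distinct.  If Z j = X for infinitely many j, then
V is multifinite.  Otherwise those members of Q whose interval has a union other
than X form a member of BB, and sending each to the union of its interval is a
finite-to-one derefinement. *)
Lemma gimel_block_ranked V Q (b h : set X -> nat) :
    Covers X V -> BB Q -> finite_to_one V b -> finite_to_one Q h ->
    (forall W, Q W -> W `<=` \bigcup_(U in V `&` b @^-1` [set h W]) U) ->
  gimel BB V.
Proof.
move=> Vcov BQ bfin hfin Wb; split=> //.
have [x0 _] := X_inhabited.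
have tail m x : exists W, [/\ Q W, W x & (m <= h W)%N].
  have [W [QW Wm] Wx] := Covers_covers x
    (BB_covers (Ramseyan_cofinite BQ (finite_to_one_below m hfin))).
  exists W; split=> //; rewrite leqNgt; apply/negP => hWm.
  exact: Wm.
pose Y i j := \bigcup_(U in [set U | V U /\ (i <= b U < j)%N]) U.
(* The point x0 makes every interval contain a member of V, so that all pieces
of the partition are nonempty. *)
pose R m n := (exists W, [/\ Q W, W x0 & (m <= h W < n)%N]) /\
  forall i j, (i < m)%N -> (j <= m)%N -> Y i j <> setT -> ~ Y m n `<=` Y i j.
have [m|k [J [kJ kR]]] := @interval_blocks R.
  have [W [QW Wx0 mW]] := tail m x0.
  have /choice[N NP] (p : nat * nat) : exists n, Y p.1 p.2 <> setT ->
      exists2 U, V U /\ (m <= b U < n)%N & ~ U `<=` Y p.1 p.2.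
    have [|/existsNP[x xY]] := pselect (forall x, Y p.1 p.2 x).
      by move=> YT; exists 0%N; case; apply/seteqP; split.
    have [W' [QW' W'x mW']] := tail m x.
    have [U [VU /= bU] Ux] := Wb W' QW' x W'x.
    by exists (h W').+1 => _; exists U; [rewrite bU mW' ltnS leqnn|move/(_ x Ux)].
  have [n nP] := finite_bounded N (finite_setX (finite_II m) (finite_II m.+1)).
  exists (maxn n (h W).+1) => n'; rewrite geq_max => /andP[nn' Wn']; split.
    by exists W; rewrite mW Wn'.
  move=> i j im jm /(NP (i, j))[U [VU /andP[mU Un]] UY] sub; apply: UY.
  apply: subset_trans sub; apply: bigcup_sup; split=> //.
  rewrite mU (leq_trans Un)// (leq_trans _ nn')// ltnW//.
  by apply: (nP (i, j)).
pose B j := V `&` (J \o b) @^-1` [set j].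
have JE j n : (k j <= n < k j.+1)%N -> J n = j.
  by rewrite -kJ ltnNge -kJ -ltnNge ltnS => ?; apply/eqP; rewrite eqn_leq andbC.
have kJn n : (k (J n) <= n < k (J n).+1)%N by rewrite -kJ leqnn ltnNge -kJ ltnn.
have YE j : Y (k j) (k j.+1) = \bigcup_(U in B j) U.
  suff -> : B j = [set U | V U /\ (k j <= b U < k j.+1)%N] by [].
  by apply/seteqP; split=> U [VU /=]; [move=> <-|move/JE].
pose Z j := \bigcup_(U in B j) U.
have kmono i j : (i <= j)%N -> (k i <= k j)%N.
  by move=> ij; rewrite -kJ (leq_trans ij)// kJ.
have klt i j : (i < j)%N -> (k i < k j)%N.
  move=> ij; have [[W [_ _ /andP[iW Wi]]] _] := kR i.
  by rewrite (leq_ltn_trans iW)// (leq_trans Wi)// kmono.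
have Zlt i j : (i < j)%N -> Z i <> setT -> Z j <> Z i.
  rewrite /Z -!YE => ij ZT ZE; have [_ kj] := kR j.
  by apply: kj ZT _; [exact: klt|exact: kmono|rewrite ZE].
have Zinj i j : Z i <> setT -> Z i = Z j -> i = j.
  move=> ZiT Zij; case: (ltngtP i j) => // ij; first by case: (Zlt i j ij ZiT).
  by case: (Zlt j i ij) => //; rewrite -Zij.
have WZ W : Q W -> W `<=` Z (J (h W)).
  by move=> QW x /(Wb W QW)[U [VU /= bU] Ux]; exists U => //; split=> //=; rewrite bU.
have hit j : exists W, [/\ Q W, W x0 & J (h W) = j].
  by have [[W [QW Wx0 /JE JW]] _] := kR j; exists W.
have Jhfin j : finite_set (Q `&` (J \o h) @^-1` [set j]).
  apply: (sub_finite_set _ (finite_to_one_below (k j.+1) hfin)) => W [QW /= <-].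
  by split=> //; case/andP: (kJn (h W)).
have Bfin j : finite_set (B j).
  apply: (sub_finite_set _ (finite_to_one_below (k j.+1) bfin)) => U [VU /= <-].
  by split=> //; case/andP: (kJn (b U)).
have [Dfin|Dinf] := pselect (finite_set [set j | Z j = setT]); last first.
  left; apply: (@multifiniteI _ _ _ [set j | Z j = setT] B) => //.
  - by move=> j _ U [].
  - move=> j x /= ZT; have : setT x by [].
    by rewrite -ZT => -[U]; exists U.
  - move=> U _; apply: (sub_finite_set _ (finite_set1 (J (b U)))).
    by move=> j [_ [_ <-]].
right; exists (range B); split.
- split.
  + apply/seteqP; split=> [U [_ [j _ <-] []//]|U VU].
    by exists (B (J (b U))); [exists (J (b U))|split].
  + by move=> _ _ [i _ <-] [j _ <-] [U [[_ <-] [_ <-]]].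
  + move=> _ [j _ <-]; have [W [QW Wx0 <-]] := hit j.
    by have [U BU _] := WZ W QW x0 Wx0; exists U.
- by move=> _ [j _ <-].
pose E := \bigcup_(j in [set j | Z j = setT]) (Q `&` (J \o h) @^-1` [set j]).
have BQE : BB (Q `\` E) by apply: Ramseyan_cofinite BQ _; exact: bigcup_finite.
have QEP W : (Q `\` E) W -> Q W /\ Z (J (h W)) <> setT.
  by move=> [QW EW]; split=> // ZT; apply: EW; exists (J (h W)).
apply: (BB_derefinable BQE).
- split.
  + apply: sub_countable (card_image_le Z [set: nat]).
    by apply: subset_card_le => _ [[_ [j _ <-] <-] _]; exists j.
  + move=> _ [[_ [j _ <-] <-] _]; apply: bigcup_open => U [VU _].
    by case: Vcov => _ + _ _; exact.
  + apply/seteqP; split=> // x _.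
    have [W QW Wx] := Covers_covers x (BB_covers BQE).
    have [QW' ZT] := QEP W QW.
    exists (Z (J (h W))); last exact: WZ.
    by split=> //; exists (B (J (h W))) => //; exists (J (h W)).
  + by move=> [_]; apply.
- exists (fun W => Z (J (h W))); split.
  + apply/seteqP; split=> [_ [W /QEP[QW ZT] <-]|_ [[_ [j _ <-] <-] ZT]].
      by split=> //; exists (B (J (h W))) => //; exists (J (h W)).
    have [W [QW _ Wj]] := hit j; exists W; last by rewrite Wj.
    split=> // -[i ZiT [_ /= ]]; rewrite Wj => ji; apply: ZT.
    by rewrite -ZiT -ji.
  + move=> y; apply: finite_set_ifN0 => -[W [/QEP[QW ZT] /= ZW]].
    apply: (sub_finite_set _ (Jhfin (J (h W)))) => W' [/QEP[QW' _] /= ZW'].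
    by split=> //=; apply/esym/Zinj => //; rewrite ZW ZW'.
  + by move=> W [QW _]; exact: WZ.
Qed.

(** Colour the cliques F W of the graph that joins two members of V when some F W
contains both.  Within a colour class chosen by the Ramsey property, each F W
lies in a single block, which reduces the claim to disjoint blocks. *)
Lemma gimel_point_finite V Q (F : set X -> set (set X)) :
    Covers X V -> BB Q ->
    (forall W, Q W -> [/\ F W `<=` V, F W !=set0, finite_set (F W) &
                          W `<=` \bigcup_(U in F W) U]) ->
    (forall U, V U -> finite_set [set W | Q W /\ F W U]) ->
  gimel BB V.
Proof.
move=> Vcov BQ FP Fpf.
pose L U U' := exists2 W, Q W & F W U /\ F W U'.
have [] := @sparse_colouring _ V L _ Q F.
- by case: Vcov.
- move=> U VU; apply: (@sub_finite_set _ _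
    (\bigcup_(W in [set W | Q W /\ F W U]) F W)).
    by move=> U' [_ [W QW [FU FU']]]; exists W.
  by apply: bigcup_finite (Fpf U VU) _ => W [/FP[]].
- by move=> U U' _ _ [W QW []]; exists W.
- by move=> W /FP[].
- by move=> W U U' QW FU FU'; exists W.
move=> col [b [col3 bfin bE]].
have [|c BQc] := Ramseyan_colour BB_Ramseyan (col := col) (m := 3) BQ.
  by move=> W _.
have /choice[u uP] W : exists U, Q W -> F W U.
  have [/FP[_ [U FU] _ _]|nQ] := pselect (Q W); first by exists U.
  by exists setT.
apply: (gimel_block_ranked Vcov BQc (bfin c) (h := b c \o u)) => [n|W [QW /= Wc]].
  apply: (@sub_finite_set _ _ (\bigcup_(U in V `&` b c @^-1` [set n])
      [set W | Q W /\ F W U])).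
    move=> W [[QW _] /= bn]; exists (u W); last by split=> //; exact: uP.
    by split=> //; have [+ _ _ _] := FP W QW; apply; exact: uP.
  by apply: bigcup_finite => [|U [VU _]]; [exact: bfin|exact: Fpf].
have [FV _ _ WF] := FP W QW.
move=> x /WF[U FU Ux]; exists U => //; split; first exact: FV.
by apply: (bE c W W _ _ QW QW Wc Wc FU (uP W QW)); exists W; have := uP W QW.
Qed.

(** The images under g of the pieces of a partition of V may overlap, but they
form a point-finite family, since g is finite-to-one. *)
Lemma gimel_derefinable V (g : set X -> set X) :
    gimel BB V -> Covers X (g @` V) -> finite_to_one V g ->
    (forall U, V U -> U `<=` g U) ->
  gimel BB (g @` V).
Proof.
move=> [Vcov VP] gVcov gfin Ug.
have gpf P : partition P id V ->
    forall y, finite_set [set F | P F /\ (g @` F) y].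
  move=> [PV Pdisj _] y.
  apply: (sub_finite_set (B := \bigcup_(U in V `&` g @^-1` [set y])
      [set F | P F /\ F U])).
    move=> F [PF [U FU gU]]; exists U => //; split=> //.
    by rewrite -PV; exists F.
  by apply: bigcup_finite => [|U _]; [exact: gfin|exact: disjoint_point_finite].
have PsubV P F : partition P id V -> P F -> F `<=` V.
  by move=> [<- _ _] PF U FU; exists F.
case: VP => [[P [Ppart Pinf PP]]|[P [Ppart Pfin BQ]]].
  split=> //; left; apply: (multifiniteI (D := P) (G := fun F => g @` F)) => //.
  - by move=> F PF; apply: image_subset; exact: PsubV Ppart PF.
  - move=> F x PF; have [_ Fcov] := PP F PF.
    have [U FU Ux] := Covers_covers x Fcov.
    exists (g U); first by exists U.
    exact: (Ug U (PsubV _ _ Ppart PF _ FU)).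
  - by move=> y _; exact: gpf.
  - by move=> F /PP[Ffin _]; exact: finite_image.
have /choice[F FP] W : exists F,
    [set \bigcup_(U in F) U | F in P] W -> P F /\ \bigcup_(U in F) U = W.
  have [[F PF <-]|nW] := pselect ([set \bigcup_(U in F) U | F in P] W).
    by exists F.
  by exists set0.
apply: (gimel_point_finite gVcov BQ (F := fun W => g @` F W)).
  move=> W [/FP[PF FW] _]; split.
  - by apply: image_subset; exact: PsubV Ppart PF.
  - by case: Ppart => _ _ /(_ _ PF)[U FU]; exists (g U); exists U.
  - by apply: finite_image; exact: Pfin.
  - rewrite -{1}FW => x [U FU Ux]; exists (g U); first by exists U.
    exact: (Ug U (PsubV _ _ Ppart PF _ FU)).
move=> y _; apply: (@sub_finite_set _ _ ((fun F => \bigcup_(U in F) U) @`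
    [set F | P F /\ (g @` F) y])).
  by move=> W [[/FP[PF FW] _] gFy]; exists (F W).
by apply: finite_image; exact: gpf.
Qed.

(** A member of gimel can be thinned out to blocks of one colour.  In the
multifinite case this is the pigeonhole principle; otherwise one block is chosen
for each member of the associated cover in BB, which is then coloured by its
block and split by the Ramsey property. *)
Lemma gimel_partition_colour V : gimel BB V ->
  exists P : set (set (set X)), [/\ partition P id V,
    forall F, P F -> finite_set F &
    forall (col : set (set X) -> nat) m, (forall F, P F -> (col F < m)%N) ->
      exists c, exists2 P', P' `<=` P `&` col @^-1` [set c] &
        gimel BB (\bigcup_(F in P') F)].
Proof.
move=> [Vcov VP].
have subP (P P' : set (set (set X))) : P' `<=` P -> partition P id V ->
    [/\ partition P' id (\bigcup_(F in P') F) & \bigcup_(F in P') F `<=` V].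
  move=> P'P [PV Pdisj PN0]; split; last first.
    by move=> U [F /P'P PF FU]; rewrite -PV; exists F.
  by split=> [//|F F' /P'P PF /P'P PF'|F /P'P/PN0//]; exact: Pdisj.
case: VP => [[P [Ppart Pinf PP]]|[P [Ppart Pfin BQ]]]; exists P; split=> //.
- by move=> F /PP[].
- move=> col m colm.
  have [c Pcinf] : exists c, infinite_set (P `&` col @^-1` [set c]).
    apply/not_existsP => noc; apply: Pinf.
    apply: (sub_finite_set (B := \bigcup_(c in `I_m) (P `&` col @^-1` [set c]))).
      by move=> F PF; exists (col F) => //; exact: colm.
    apply: bigcup_finite => [|c _]; first exact: finite_II.
    by apply: contrapT => Pcinf; apply: (noc c).
  exists c; exists (P `&` col @^-1` [set c]) => //.
  have [P'part P'V] := subP P (P `&` col @^-1` [set c]) (@subIsetl _ _ _) Ppart.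
  split; last first.
    by left; exists (P `&` col @^-1` [set c]); split=> // F [/PP].
  apply: sub_Covers Vcov P'V _ => x.
  have [F [PF Fc]] := infinite_setN0 Pcinf.
  have [_ Fcov] := PP F PF; have [U FU Ux] := Covers_covers x Fcov.
  by exists U => //; exists F.
- move=> col m colm.
  have /choice[F FP] W : exists F,
      [set \bigcup_(U in F) U | F in P] W -> P F /\ \bigcup_(U in F) U = W.
    have [[F PF <-]|nW] := pselect ([set \bigcup_(U in F) U | F in P] W).
      by exists F.
    by exists set0.
  have [|c BQc] := Ramseyan_colour BB_Ramseyan (col := col \o F) (m := m) BQ.
    by move=> W [/FP[PF _] _]; exact: colm.
  set Qc := _ `&` _ in BQc.
  have QcP W : Qc W ->
      [/\ P (F W), \bigcup_(U in F W) U = W, W <> setT & col (F W) = c].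
    by move=> [[/FP[? ?] ?] ?].
  have P'P : F @` Qc `<=` P by move=> _ [W /QcP[? _ _ _] <-].
  have [P'part P'V] := subP P (F @` Qc) P'P Ppart.
  exists c; exists (F @` Qc).
    by move=> _ [W /QcP[? _ _ ?] <-].
  split.
    apply: sub_Covers Vcov P'V _ => x.
    have [W QcW Wx] := Covers_covers x (BB_covers BQc).
    have [_ FW _ _] := QcP W QcW.
    move: Wx; rewrite -FW => -[U FU Ux]; exists U => //.
    by exists (F W) => //; exists W.
  right; exists (F @` Qc); split=> //; first by move=> G /P'P/Pfin.
  suff -> : [set \bigcup_(W in G) W | G in F @` Qc] `\ setT = Qc by [].
  apply/seteqP; split=> [_ [[_ [W QcW <-] <-] _]|W QcW].
    by have [_ -> _ _] := QcP W QcW.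
  have [_ FW WT _] := QcP W QcW.
  by split=> //; exists (F W) => //; exists W.
Qed.

End Gimel.

(** * Omega-covers *)

Lemma pair_n_subsets (T : Type) (A : set T) (x y : T) :
  A x -> A y -> x <> y -> n_subsets 2 A [set x; y].
Proof.
elim/Pchoice: T => T in A x y *.
move=> Ax Ay xy; split=> [z [->|->]//|].
have -> : [set x; y] = [set` [fset x; y]%fset].
  apply/seteqP; split=> z /=; rewrite !inE.
    by case=> ->; rewrite eqxx ?orbT.
  by case/orP=> /eqP ->; [left|right].
by apply/card_eq_fsetP; rewrite cardfs2; case: eqP.
Qed.

Lemma ultra_finite_colour (T : Type) (F : set_system T) (col : T -> nat) m :
  UltraFilter F -> F [set x | (col x < m)%N] -> exists j, F (col @^-1` [set j]).
Proof.
move=> FU; elim: m => [|m IH] Fm.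
  suff : F set0 by move/filter_not_empty.
  by apply: filterS Fm => x.
have [|FC] := in_ultra_setVsetC (col @^-1` [set m]) FU; first by exists m.
apply: IH; apply: filterS (filterI Fm FC) => x [/=]; rewrite ltnS leq_eqVlt.
by case/orP => [/eqP|].
Qed.

Section Omega.
Variable X : topologicalType.
Implicit Types (U W : set X) (A : set (set X)).

Lemma sub_Omega A A' : Omega X A -> A' `<=` A ->
  (forall K : set X, finite_set K -> exists2 W, A' W & K `<=` W) -> Omega X A'.
Proof.
move=> [Acov _] A'A A'P; split=> //; apply: sub_Covers Acov A'A _ => x.
by have [W A'W xW] := A'P _ (finite_set1 x); exists W => //; exact: xW.
Qed.

Lemma Omega_inhabited A : Omega X A -> [set: X] !=set0.
Proof.
move=> [[_ _ _ AT] AP]; apply/set0P/eqP => X0; apply: AT.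
have [W AW _] := AP _ (@finite_set0 X).
suff <- : W = setT by [].
by rewrite X0; apply/seteqP; split=> // x Wx; have : [set: X] x by []; rewrite X0.
Qed.

(** Choose a point outside each member of E; no member of E contains all of
these points. *)
Lemma Omega_avoid A E : Omega X A -> finite_set E ->
  exists2 K : set X, finite_set K & forall W, A W -> K `<=` W -> ~ E W.
Proof.
move=> AO Efin; have [x0 _] := Omega_inhabited AO.
have [[_ _ _ AT] _] := AO.
have /choice[p pP] W : exists x, A W -> ~ W x.
  have [AW|nAW] := pselect (A W); last by exists x0.
  have /existsNP[x Wx] : ~ forall x, W x.
    by move=> WT; apply: AT; suff <- : W = setT by []; apply/seteqP; split.
  by exists x.
exists (p @` E); first exact: finite_image.
by move=> W AW pW EW; apply: (pP W AW); apply: pW; exists W.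
Qed.

Lemma Omega_cofinite A E : Omega X A -> finite_set E -> Omega X (A `\` E).
Proof.
move=> AO Efin; have [K Kfin KP] := Omega_avoid AO Efin.
apply: (sub_Omega AO) => [W []//|K' K'fin].
have [_ /(_ (K `|` K'))[|W AW]] := AO.
  by rewrite finite_setU.
rewrite subUset => -[KW K'W].
by exists W => //; split=> //; exact: KP.
Qed.

(** The members of A above a given finite set form a filter base, because finite
sets are directed; a set that meets all members of the base is again an
omega-cover. *)
Lemma Omega_ultrafilter A : Omega X A ->
  exists F : set_system (set X), [/\ UltraFilter F,
    forall K : set X, finite_set K -> F [set W | A W /\ K `<=` W] &
    forall S, F S -> S `<=` A -> Omega X S].
Proof.
move=> AO; have [_ AP] := AO.
have Bproper : ProperFilter (filter_from [set K : set X | finite_set K]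
    (fun K => [set W | A W /\ K `<=` W])).
  apply: filter_from_proper; last first.
    by move=> K /AP[W AW KW]; exists W.
  apply: filter_from_filter; first by exists set0; exact: finite_set0.
  move=> K K' Kfin K'fin; exists (K `|` K'); first by rewrite /= finite_setU.
  by move=> W [AW]; rewrite subUset => -[KW K'W].
have [F [FU FB]] := ultraFilterLemma Bproper.
have FA K : finite_set K -> F [set W | A W /\ K `<=` W].
  by move=> Kfin; apply: FB; exists K.
exists F; split=> // S FS SA; apply: (sub_Omega AO SA) => K /FA FK.
by have [W [SW [_ KW]]] := filter_ex (filterI FS FK); exists W.
Qed.

(** The ultrafilter form of Ramsey's argument for pairs: c U is the colour of
{U, W} for almost all W, and j is the value of c U for almost all U. *)
Lemma Omega_end_homogeneous A (f : set (set X) -> nat) k : Omega X A ->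
    set_fun (n_subsets 2 A) [set j | (1 <= j <= k)%N] f ->
  exists C j, [/\ C `<=` A, (1 <= j <= k)%N &
    forall E, finite_set E -> E `<=` C ->
      Omega X [set W | C W /\ forall U, E U -> f [set U; W] = j]].
Proof.
move=> AO fk; have [F [FU FA FO]] := Omega_ultrafilter AO.
have /choice[c cP] U : exists c, A U ->
    (1 <= c <= k)%N /\ F [set W | f [set U; W] = c].
  have [AU|nAU] := pselect (A U); last by exists 0%N.
  have [K Kfin KU] := Omega_avoid AO (finite_set1 U).
  have Fk : F [set W | (1 <= f [set U; W] <= k)%N].
    apply: filterS (FA K Kfin) => W [AW KW]; apply: fk.
    by apply: pair_n_subsets => // UW; apply: (KU W).
  have [|c Fc] := @ultra_finite_colour _ F (fun W => f [set U; W]) k.+1 FU.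
    by apply: filterS Fk => W /andP[].
  by exists c => _; split=> //; have [W [/= <-]] := filter_ex (filterI Fc Fk).
have FA' : F A by apply: filterS (FA set0 (@finite_set0 _)) => W [].
have [|j Fj] := @ultra_finite_colour _ F c k.+1 FU.
  by apply: filterS FA' => U /cP[/andP[]].
have FC : F (A `&` c @^-1` [set j]) by exact: filterI.
exists (A `&` c @^-1` [set j]), j; split=> [U []//||E Efin EC].
  by have [U [/cP[+ _] /= <-]] := filter_ex FC.
apply: FO => [|W [[]]//].
apply: filterI FC _.
have /finite_fsetP[D DE] := Efin.
have := @filter_bigI _ _ D (fun U => [set W | f [set U; W] = j]) F _.
rewrite -DE => H.
suff : F (\bigcap_(U in E) [set W | f [set U; W] = j]) by [].
apply: H => U UD; have /EC[AU /= <-] : E U by rewrite DE.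
by have [] := cP U AU.
Qed.

End Omega.

(** * The equivalence *)

Section Equivalence.
Variables (X : topologicalType) (BB : set (set (set X))).
Hypothesis BB_covers : BB `<=` Covers X.
Hypothesis BB_Ramseyan : Ramseyan BB.
Hypothesis BB_derefinable : finite_to_one_derefinable BB.

(** The selected V has only finitely many edges of the wrong colour at each
vertex; a colour class of the blocks of V that is sparse for the graph of wrong
pairs and common blocks gives the homogeneous family. *)
Lemma Sfin_BaumgartnerTaylor k : Sfin (Omega X) (gimel BB) ->
  BaumgartnerTaylor (Omega X) (gimel BB) k.
Proof.
move=> XS A AO f fk.
have Xinh := Omega_inhabited AO.
have [C [j [CA jk CE]]] := Omega_end_homogeneous AO fk.
have [[Acnt _ _ _] _] := AO.
have [r rfin] := countable_rank Acnt.
pose good n := [set W | C W /\ forall U, (C `&` [set U | r U < n]%N) U ->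
  f [set U; W] = j].
have [|F [FP BV]] := XS good.
  move=> n; apply: CE => [|U []//].
  by apply: (sub_finite_set _ (finite_to_one_below n rfin)) => U [/CA].
set V := \bigcup_n F n in BV.
have VC : V `<=` C by move=> W [n _ /(FP n).2[]].
have fV U : V U -> finite_set [set W | V W /\ f [set U; W] <> j].
  move=> VU; apply: (sub_finite_set (B := \bigcup_(n in `I_(r U).+1) F n)).
    move=> W [[n _ FW] fj]; exists n => //=; rewrite ltnNge; apply/negP => Un.
    by apply: fj; have [_] := (FP n).2 W FW; apply; split=> //; exact: VC.
  by apply: bigcup_finite => [|n _]; [exact: finite_II|exact: (FP n).1].
have [P [[PV Pdisj PN0] Pfin Pcol]] := gimel_partition_colour BB_covers BB_Ramseyan BV.
have PsubV F' : P F' -> F' `<=` V by move=> PF' U FU; rewrite -PV; exists F'.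
pose L U W := f [set U; W] <> j \/ exists2 F', P F' & F' U /\ F' W.
have [] := @sparse_colouring _ V L _ P id.
- by case: BV => -[].
- move=> U VU; apply: (sub_finite_set (B := [set W | V W /\ f [set U; W] <> j] `|`
      \bigcup_(F' in [set F' | P F' /\ F' U]) F')).
    by move=> W [VW [fj|[F' PF' [F'U F'W]]]]; [left|right; exists F'].
  rewrite finite_setU; split; first exact: fV.
  by apply: bigcup_finite => [|F' [/Pfin]//]; exact: disjoint_point_finite.
- move=> U W _ _ [fj|[F' PF' [F'U F'W]]]; first by left; rewrite setUC.
  by right; exists F'.
- exact: PsubV.
- by move=> F' U W PF' F'U F'W; right; exists F'.
move=> col [b [col3 bfin bE]].
have [|c [P' P'P BB']] := Pcol col 3; first by move=> F' _.
exists (\bigcup_(F' in P') F'),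
  (fun n => (\bigcup_(F' in P') F') `&` b c @^-1` [set n]), j.
have P'V : \bigcup_(F' in P') F' `<=` V by move=> U [F' /P'P[/PsubV F'V _] /F'V].
split=> //; first exact: subset_trans P'V (subset_trans VC CA).
  split.
  - apply/seteqP; split=> [U [n _ []//]|U B'U].
    by exists (b c U).
  - by move=> m n _ _ [U [[_ /= <-] [_ /= <-]]].
  - move=> n; apply: (sub_finite_set _ (bfin c n)) => U [/P'V VU /= bU].
    by split.
move=> U W [F1 P'F1 F1U] [F2 P'F2 F2W] sep; apply: contrapT => fj; apply: sep.
have [PF1 c1] := P'P F1 P'F1; have [PF2 c2] := P'P F2 P'F2.
exists (b c U); split; split=> //; [by exists F1|by exists F2|].
by rewrite /= (bE c F1 F2 U W)//; left.
Qed.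

(** Colour the intersections W.1 `&` W.2 by agreement of first factors.  The rank
of the first factor tells from which cover the second factor was taken, so
homogeneity in the second colour bounds the selection from each cover. *)
Lemma BaumgartnerTaylor_Sfin : BaumgartnerTaylor (Omega X) (gimel BB) 2 ->
  Sfin (Omega X) (gimel BB).
Proof.
move=> BT G GO.
have Xinh := Omega_inhabited (GO 0%N).
have Gcnt : countable (\bigcup_n G n).
  by apply: bigcup_countable => // n _; have [[]] := GO n.
have [r rfin] := countable_rank Gcnt.
(* Each set lies in only finitely many H n, which makes the passage to second
factors finite-to-one. *)
pose H n := G n `\` [set W | (\bigcup_m G m) W /\ (r W < n.+1)%N].
have HO n : Omega X (H n).
  by apply: Omega_cofinite (GO n) _; exact: finite_to_one_below.
have Hr n W : H n W -> (n < r W)%N.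
  move=> [GW rW]; rewrite ltnNge; apply/negP => Wn; apply: rW.
  by split=> //; exists n.
pose A := [set W.1 `&` W.2 | W in [set W : set X * set X |
  H 0%N W.1 /\ H (r W.1) W.2]].
have HT n W : H n W -> open W /\ W <> setT.
  have [[_ Ho _ HnT] _] := HO n; move=> HW; split; first exact: Ho.
  by move=> WT; apply: HnT; rewrite -WT.
have Acap K : finite_set K -> exists2 W, A W & K `<=` W.
  move=> Kfin; have [W HW KW] := (HO 0%N).2 K Kfin.
  have [W' HW' KW'] := (HO (r W)).2 K Kfin.
  by exists (W `&` W'); [exists (W, W')|rewrite subsetI].
have AO : Omega X A.
  split=> //; split.
  - apply: (sub_countable (card_image_le _ _)).
    apply: (@sub_countable _ _ _ ((\bigcup_n G n) `*` (\bigcup_n G n))).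
      apply: subset_card_le => -[W W'] [/= [GW _] [GW' _]].
      by split; [exists 0%N|exists (r W)].
    exact: countableX.
  - by move=> _ [[W W'] /= [/HT[Wo _] /HT[W'o _]] <-]; exact: openI.
  - apply/seteqP; split=> // x _; have [W AW xW] := Acap _ (finite_set1 x).
    by exists W => //; exact: xW.
  - move=> [[W W'] /= [/HT[_ WT] _] WW']; apply: WT.
    by apply/seteqP; split=> // x _; have : setT x by []; rewrite -WW' => -[].
(* An intersection may arise in several ways; p fixes one of them. *)
have /choice[p pP] W : exists p : set X * set X,
    A W -> [/\ H 0%N p.1, H (r p.1) p.2 & W = p.1 `&` p.2].
  have [[p [Hp1 Hp2] <-]|nAW] := pselect (A W); first by exists p.
  by exists (set0, set0).
pose f S := if `[< forall U W, S U -> S W -> (p U).1 = (p W).1 >] then 1%N else 2%N.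
have f1 U W : f [set U; W] = 1%N -> (p U).1 = (p W).1.
  by rewrite /f; case: asboolP => // + _; apply; [left|right].
have f2 U W : f [set U; W] = 2%N -> (p U).1 <> (p W).1.
  rewrite /f; case: asboolP => // nE _ E; apply: nE.
  by move=> U' W' [->|->] [->|->].
have [|V [Bn [j [VA BV [VE Bdisj Bfin] j12 fj]]]] := BT A AO f.
  by move=> S _; rewrite /f /=; case: ifP.
have [Vcov _] := BV.
have sep U W n : V U -> V W -> Bn n U -> ~ Bn n W -> f [set U; W] = j.
  move=> VU VW BU BW; apply: fj => // -[m [BmU BmW]]; apply: BW.
  by rewrite (Bdisj n m)//; exists U.
have block U : V U -> exists n, Bn n U.
  by rewrite -VE => -[n _ BU]; exists n.
(* In the first colour all members of V share the first factor of U: a member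
in another block directly, one in the block of U by comparison with W.  So this
first factor contains the union of V, which is the whole space. *)
have {j12} [j1|j2] : j = 1%N \/ j = 2%N by case/andP: j12; lia.
  have Vinf := gimel_infinite BB_covers BB_Ramseyan BV.
  have [U VU] := infinite_setN0 Vinf; have [n BU] := block U VU.
  have [W [VW BW]] := infinite_setN0 (infinite_setD Vinf (Bfin n)).
  have UW : (p U).1 = (p W).1 by apply: f1; rewrite (sep U W n).
  have [HU _ _] := pP U (VA U VU).
  have [_ []] := HT _ _ HU; apply/seteqP; split=> // x _.
  have [Z VZ Zx] := Covers_covers x Vcov.
  suff <- : (p Z).1 = (p U).1.
    have [_ _ ZE] := pP Z (VA Z VZ).
    by have [] : ((p Z).1 `&` (p Z).2) x by rewrite -ZE.
  have [BZ|BZ] := pselect (Bn n Z).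
    by rewrite UW; apply: f1; rewrite (sep Z W n).
  by apply/esym/f1; rewrite (sep U Z n).
have fibre W0 : finite_set (V `&` [set W | (p W).1 = W0]).
  apply: finite_set_ifN0 => -[U [VU /= <-]]; have [n BU] := block U VU.
  apply: (sub_finite_set _ (Bfin n)) => W [VW /= pE].
  by apply: contrapT => BW; apply: (f2 U W); rewrite ?(sep U W n).
have rank_fin n : finite_set (V `&` [set W | r (p W).1 = n]).
  apply: (sub_finite_set (B := \bigcup_(W0 in (\bigcup_m G m) `&` r @^-1` [set n])
      (V `&` [set W | (p W).1 = W0]))).
    move=> W [VW /= rn]; exists (p W).1 => //; split=> //.
    by have [[GW _] _ _] := pP W (VA W VW); exists 0%N.
  by apply: bigcup_finite => [|W0 _]; [exact: rfin|exact: fibre].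
exists (fun n => [set (p W).2 | W in V `&` [set W | r (p W).1 = n]]); split.
  move=> n; split; first exact: finite_image.
  by move=> _ [W [VW /= <-] <-]; have [_ [GW _] _] := pP W (VA W VW).
have -> : \bigcup_n [set (p W).2 | W in V `&` [set W | r (p W).1 = n]] =
    (fun W => (p W).2) @` V.
  apply/seteqP; split=> [_ [n _ [W [VW _] <-]]|_ [W VW <-]]; first by exists W.
  by exists (r (p W).1) => //; exists W.
have Vp W : V W -> W `<=` (p W).2.
  by move=> VW; have [_ _ WE] := pP W (VA W VW); rewrite {1}WE => x [].
have VH W : V W -> H (r (p W).1) (p W).2.
  by move=> VW; have [_ ? _] := pP W (VA W VW).
apply: gimel_derefinable => //.
- have [Vcnt _ _ _] := Vcov; split.
  + exact: sub_countable (card_image_le _ _) Vcnt.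
  + by move=> _ [W /VH/HT[Wo _] <-].
  + apply/seteqP; split=> // x _; have [W VW Wx] := Covers_covers x Vcov.
    by exists (p W).2; [exists W|exact: Vp].
  + by move=> [W /VH/HT[_ WT] /WT].
- move=> W0; apply: (sub_finite_set (B := \bigcup_(n in `I_(r W0))
      (V `&` [set W | r (p W).1 = n]))).
    by move=> W [VW /= <-]; exists (r (p W).1) => //=; exact/Hr/VH.
  by apply: bigcup_finite => [|n _]; [exact: finite_II|exact: rank_fin].
Qed.

End Equivalence.

Theorem theorem13 (X : topologicalType) (BB : set (set (set X)))
    (BB_covers : BB `<=` Covers X)
    (BB_Ramseyan : Ramseyan BB)
    (BB_derefinable : finite_to_one_derefinable BB) :
  (Sfin (Omega X) (gimel BB) <->
   (forall k : nat, (0 < k)%N -> BaumgartnerTaylor (Omega X) (gimel BB) k)) /\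
  ((forall k : nat, (0 < k)%N -> BaumgartnerTaylor (Omega X) (gimel BB) k) <->
   BaumgartnerTaylor (Omega X) (gimel BB) 2).
Proof.
have Sfin_BT k : Sfin (Omega X) (gimel BB) ->
    BaumgartnerTaylor (Omega X) (gimel BB) k.
  exact: Sfin_BaumgartnerTaylor.
have BT_Sfin : BaumgartnerTaylor (Omega X) (gimel BB) 2 ->
    Sfin (Omega X) (gimel BB).
  exact: BaumgartnerTaylor_Sfin.
split; split.
- by move=> S k _; exact: Sfin_BT.
- by move=> BT; exact/BT_Sfin/BT.
- exact.
- by move=> BT k _; exact/Sfin_BT/BT_Sfin.
Qed.
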